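(* Let $\sigma$ be a $p$-face of the unit $n$-cube $\square^n$, and let $\omega$ be a smooth $0$-form (smooth real function) on $\square^n$. For any small $p$-cube $\upsilon$ of $\square^n$ (of any order $k\ge1$), we have $$\int_{\upsilon}\omega\,\mathcal{W}\sigma=\Big(\frac1{|\upsilon|}\int_{\upsilon}\omega\Big)\,\langle\mathcal{W}\sigma(x),\operatorname{vect}(\upsilon)\rangle,$$ where $x$ is any point in $\upsilon$.
   Context: $\square^n=[0,1]^n$. $\mathcal{J}(n,k-1)$ is the set of multi-indices $\mathbf{k}=(k_1,\ldots,k_n)$ of integers with $0\le k_i\le k-1$, and for $\mathbf{k}\in\mathcal{J}(n,k-1)$ the map $\mathbf{k}_{k-1}:\square^n\to\square^n$ is $\mathbf{k}_{k-1}(x_1,\ldots,x_n)=\frac{1}{k}(k_1+x_1,\ldots,k_n+x_n)$. The $k$th order small $p$-cubes of $\square^n$ are the sets $\mathbf{k}_{k-1}(\tau)$ with $\mathbf{k}\in\mathcal{J}(n,k-1)$ and $\tau$ a $p$-face of $\square^n$. Let $x_{i_1},\ldots,x_{i_p}$ ($i_1<\ldots<i_p$) be the coordinates whose plane is parallel to $\sigma$, and let $x_{i_{p+1}},\ldots,x_{i_n}$ be the other coordinates, which have constant values $y_{i_{p+1}},\ldots,y_{i_n}\in\{0,1\}$ on $\sigma$. The lowest order cubical form of $\sigma$ is $$\mathcal{W}\sigma=\Big(\prod_{j=p+1}^n x_{i_j}^{y_{i_j}}(1-x_{i_j})^{1-y_{i_j}}\Big)\,\mathrm{d}x_{i_1}\wedge\ldots\wedge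 \mathrm{d}x_{i_p}.$$ $|\upsilon|$ is the $p$-dimensional volume of $\upsilon$ (equal to $1$ if $p=0$), $\frac1{|\upsilon|}\int_\upsilon\omega$ is the average of $\omega$ over $\upsilon$ with respect to $p$-dimensional Lebesgue measure (the value at the point if $p=0$), and $\operatorname{vect}(\upsilon)$ is the $p$-vector of the oriented cube $\upsilon$: the wedge product of its edge vectors, ordered compatibly with the orientation of $\upsilon$ used in $\int_\upsilon\omega\,\mathcal{W}\sigma$ (so its norm is $|\upsilon|$). $\langle\cdot,\cdot\rangle$ is the pairing of $p$-covectors with $p$-vectors. *)

(* Defs.v *)
From HB Require Import structures.
From mathcomp Require Import all_boot all_order all_algebra.
From mathcomp Require Import all_classical all_reals all_analysis.
Set Implicit Arguments.
Unset Strict Implicit.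
Unset Printing Implicit Defensive.
Import Order.TTheory GRing.Theory Num.Theory.
Import numFieldNormedType.Exports.
Local Open Scope classical_set_scope.
Local Open Scope ring_scope.

(* Lebesgue measure on R^p. Points of R^p are p-tuples here because tuples
   carry the product sigma-algebra in the library. *)

Section tuple_lebesgue.
Context {R : realType}.

Definition tuple_cons p (xt : R * p.-tuple R) : p.+1.-tuple R :=
  [tuple of xt.1 :: xt.2].

Lemma measurable_tuple_cons p :
  measurable_fun [set: R * p.-tuple R] (@tuple_cons p).
Proof. exact: measurable_cons measurable_fst measurable_snd. Qed.

Section step.
Context (p : nat) (mu : {sigma_finite_measure set (p.-tuple R) -> \bar R}).

Definition consm : set (p.+1.-tuple R) -> \bar R :=
  pushforward (@lebesgue_measure R \x mu)%E (@tuple_cons p).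

Let consm0 : consm set0 = 0%E.
Proof. by rewrite /consm /pushforward preimage_set0 measure0. Qed.

Let consm_ge0 A : (0 <= consm A)%E.
Proof. by rewrite /consm /pushforward; exact: measure_ge0. Qed.

Let consm_semi_sigma_additive : semi_sigma_additive consm.
Proof.
move=> F mF tF mUF; rewrite /consm /pushforward preimage_bigcup.
have mc A : measurable A -> measurable (@tuple_cons p @^-1` A).
  by move=> mA; rewrite -[X in measurable X]setTI; exact: measurable_tuple_cons.
apply: measure_semi_sigma_additive.
- by move=> n; exact: mc.
- apply/trivIsetP => /= i j _ _ ij; rewrite -preimage_setI.
  by move/trivIsetP : tF => /(_ _ _ _ _ ij) ->//; rewrite preimage_set0.
- by rewrite -preimage_bigcup; exact: mc.
Qed.

HB.instance Definition _ := isMeasure.Build _ _ _ consm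
  consm0 consm_ge0 consm_semi_sigma_additive.

Let consm_sigma_finite : sigma_finite setT consm.
Proof.
have /sigma_finiteP[F [TF ndF Foo]] := sigma_finiteT (@lebesgue_measure R).
have /sigma_finiteP[G [TG ndG Goo]] := sigma_finiteT mu.
exists (fun n => [set t : p.+1.-tuple R |
                  F n (thead t) /\ G n [tuple of behead t]]).
  rewrite predeqE => t; split => // _.
  have [n _ Fn] : (\bigcup_n F n) (thead t) by rewrite -TF.
  have [k _ Gk] : (\bigcup_n G n) [tuple of behead t] by rewrite -TG.
  exists (maxn n k) => //; split.
  - by move: Fn; exact/subsetPset/ndF/leq_maxl.
  - by move: Gk; exact/subsetPset/ndG/leq_maxr.
move=> n; have [mF Fn] := Foo n; have [mG Gn] := Goo n; split.
  apply: measurableI.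
  - by have := @measurable_tnth _ R p.+1 ord0 measurableT _ mF; rewrite setTI.
  - by have := @measurable_behead _ R p measurableT _ mG; rewrite setTI.
rewrite /consm /pushforward (_ : _ @^-1` _ = F n `*` G n).
  by rewrite product_measure1E// lte_mul_pinfty// ge0_fin_numE.
rewrite predeqE => -[x t]; rewrite /preimage /= theadE.
have -> : [tuple of behead (tuple_cons (x, t))] = t :> p.-tuple R.
  exact: val_inj.
by [].
Qed.

HB.instance Definition _ :=
  @Measure_isSigmaFinite.Build _ _ _ consm consm_sigma_finite.

End step.

Fixpoint tuple_lebesgue p : {sigma_finite_measure set (p.-tuple R) -> \bar R} :=
  match p with
  | 0 => \d_ ([tuple] : 0.-tuple R)
  | p'.+1 => consm (tuple_lebesgue p')
  end.

End tuple_lebesgue.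

Section smoothness.
Context {R : realType} {n : nat}.

Definition partial (i : 'I_n) (f : 'rV[R]_n -> R) : 'rV[R]_n -> R :=
  fun x => 'D_(delta_mx 0 i) (f : 'rV[R]_n -> R^o) x.

Definition iter_partial (s : seq 'I_n) (f : 'rV[R]_n -> R) : 'rV[R]_n -> R :=
  foldr partial f s.

Definition smooth_on (U : set 'rV[R]_n) (f : 'rV[R]_n -> R) : Prop :=
  forall (s : seq 'I_n) (x : 'rV[R]_n), U x ->
    {for x, continuous (iter_partial s f)} /\
    forall i, derivable (iter_partial s f : 'rV[R]_n -> R^o) x (delta_mx 0 i).

Definition unit_cube : set 'rV[R]_n := [set x | forall i, 0 <= x 0 i <= 1].

(* Only the values of w on the cube matter. *)
Definition smooth_on_cube (w : 'rV[R]_n -> R) : Prop :=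
  exists (U : set 'rV[R]_n) (g : 'rV[R]_n -> R),
    [/\ open U, unit_cube `<=` U, smooth_on U g & {in unit_cube, w =1 g}].

End smoothness.

Arguments unit_cube {R} n.

(* Strictly increasing multi-indices i_1 < ... < i_p in {0, ..., n-1}. *)
Definition incr p n :=
  {I : {ffun 'I_p -> 'I_n} |
    [forall a : 'I_p, forall b : 'I_p, (a < b)%N ==> (I a < I b)%N]}.

(* Exterior algebra in coordinates: an element of the p-th exterior power of
   R^n is given by its coordinates on the basis e_I, I : incr p n. Identifying
   the dual of R^n with row vectors through the basis dx_i, the same type holds
   the p-covectors, with basis dx_I dual to e_I. *)
Section exterior.
Context {R : realType} {p n : nat}.

Definition ext := {ffun incr p n -> R^o}.

(* The wedge product of the rows of A, in order *)
Definition wedge (A : 'M[R]_(p, n)) : ext :=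
  [ffun I : incr p n => \det (\matrix_(a < p, b < p) A a (val I b)) : R^o].

Definition pairing (alpha xi : ext) : R := \sum_(I : incr p n) alpha I * xi I.

End exterior.

Arguments ext R p n : clear implicits.

(* A p-face of the n-cube: dir lists the coordinates i_1 < ... < i_p whose plane
   is parallel to the face, and fixed_val i is the value (0 or 1) of any other
   coordinate i; its values on the coordinates in dir are irrelevant. *)
Record face p n := Face { dir : incr p n; fixed_val : {ffun 'I_n -> bool} }.

Definition free_coord p n (s : face p n) : {pred 'I_n} :=
  [in codom (val (dir s))].

Section cubes.
Context {R : realType} {p n : nat}.
Implicit Types (s t : face p n).

Definition face_set s : set 'rV[R]_n :=
  [set x | unit_cube n x /\
           forall i, i \notin free_coord s -> x 0 i = (fixed_val s i)%:R].

Definition lowest_form s (x : 'rV[R]_n) : ext R p n :=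
  (\prod_(i | i \notin free_coord s)
     (x 0 i ^+ (fixed_val s i) * (1 - x 0 i) ^+ (1 - fixed_val s i)))
  *: wedge (\matrix_(a < p) delta_mx 0 (val (dir s) a)).

Definition small_map k (kk : {ffun 'I_n -> 'I_k}) (x : 'rV[R]_n) : 'rV[R]_n :=
  k%:R^-1 *: \row_i ((kk i)%:R + x 0 i).

Definition small_cube k (kk : {ffun 'I_n -> 'I_k}) t : set 'rV[R]_n :=
  small_map kk @` face_set t.

(* Isometric parametrization of the coordinate plane through c parallel to the
   x_(d 0), ..., x_(d (p - 1)) coordinates. *)
Definition plane (d : incr p n) (c : 'rV[R]_n) (u : p.-tuple R) : 'rV[R]_n :=
  c + \sum_(a < p) tnth u a *: delta_mx 0 (val d a).

(* p-dimensional Lebesgue measure on such a plane *)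
Definition volume d c (S : set 'rV[R]_n) : R :=
  fine (tuple_lebesgue p (plane d c @^-1` S)).

Definition plane_integral d c (S : set 'rV[R]_n) (f : 'rV[R]_n -> R) : R :=
  \int[tuple_lebesgue p]_(u in plane d c @^-1` S) f (plane d c u).

(* The vertex of t whose free coordinates are all 0 *)
Definition corner t : 'rV[R]_n :=
  \row_i (if i \in free_coord t then 0 else (fixed_val t i)%:R).

Definition small_corner k (kk : {ffun 'I_n -> 'I_k}) t : 'rV[R]_n :=
  small_map kk (corner t).

Definition small_volume k (kk : {ffun 'I_n -> 'I_k}) t : R :=
  volume (dir t) (small_corner kk t) (small_cube kk t).

Definition average k (kk : {ffun 'I_n -> 'I_k}) t (w : 'rV[R]_n -> R) : R :=
  (small_volume kk t)^-1 *
  plane_integral (dir t) (small_corner kk t) (small_cube kk t) w.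

(* Row a is the edge vector of the small cube along the a-th free coordinate,
   as a difference of two vertices. *)
Definition edges k (kk : {ffun 'I_n -> 'I_k}) t : 'M[R]_(p, n) :=
  \matrix_(a < p) (small_map kk (corner t + delta_mx 0 (val (dir t) a))
                   - small_corner kk t).

(* An orientation of a cube is a boolean: false is the orientation for which
   the edges in increasing order of their coordinates are positively ordered,
   true is the opposite one. Reordering the edges oddly (p >= 2), or reversing
   the edge (p = 1), negates their wedge product; for p = 0 the orientation is
   the sign of the point. *)
Definition vect k (kk : {ffun 'I_n -> 'I_k}) t (o : bool) : ext R p n :=
  (-1) ^+ o *: wedge (edges kk t).

Definition unit_box : set (p.-tuple R) :=
  [set u | forall a, 0 <= tnth u a <= 1].

Definition small_param k (kk : {ffun 'I_n -> 'I_k}) t (u : p.-tuple R) :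
    'rV[R]_n :=
  small_map kk (plane (dir t) (corner t) u).

(* The integral of a p-form over the oriented small cube, by pullback to
   [0,1]^p along the affine map small_param, whose partial derivatives are the
   rows of edges. *)
Definition form_integral k (kk : {ffun 'I_n -> 'I_k}) t (o : bool)
    (eta : 'rV[R]_n -> ext R p n) : R :=
  (-1) ^+ o *
  \int[tuple_lebesgue p]_(u in unit_box)
     pairing (eta (small_param kk t u)) (wedge (edges kk t)).

End cubes.

(* Main.v *)
Require Import Defs.
From HB Require Import structures.
From mathcomp Require Import all_boot all_order all_algebra.
From mathcomp Require Import all_classical all_reals all_analysis.
From mathcomp Require Import measurable_realfun.
Set Implicit Arguments.
Unset Strict Implicit.
Unset Printing Implicit Defensive.
Import Order.TTheory GRing.Theory Num.Theory.
Local Open Scope classical_set_scope.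
Local Open Scope ring_scope.

(** Write e_s for the wedge of the basis vectors along the free coordinates of
    a face s. The form of sigma is f e_sigma, where the coefficient f involves
    only the coordinates that are fixed on sigma, and the p-vector of the small
    cube is, up to the sign of the orientation, k^-p e_tau. If <e_sigma, e_tau>
    is not 0, then sigma and tau have the same free coordinates
    (pairing_basis_neq0), so f is constant on the small cube
    (face_coef_const). In all cases the integrand of the pullback to [0,1]^p is
    therefore w times the constant <f e_sigma, k^-p e_tau>, which can be
    evaluated at any point of the cube.

    What remains is that the integral over [0,1]^p of the pullback of w is the
    average of w over the small cube (averageE). Both are integrals of w over
    the same plane, and the parametrizations differ by the homothety of ratio
    1/k of R^p. It multiplies the p-dimensional Lebesgue measure by k^-p
    (tuple_lebesgue_rescales), and the volume of the small cube by the same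
    factor, so the factors cancel in the average.

    The two facts on integrals, behaviour under a bijection that multiplies the
    measure by a constant (Rintegral_comp) and homogeneity (RintegralZ), come
    from the definition of the integral of a nonnegative function as a supremum
    over the simple functions below it. A one-sided inequality is obvious from
    that definition, and the same inequality for the inverse operation is the
    converse. *)

(** * Integrals under rescaling of the measure or of the integrand *)

Section integral_scaling.
Context d (T : measurableType d) (R : realType) (mu : {measure set T -> \bar R}).
Implicit Types (s t : T -> T) (r : R) (f : T -> \bar R).
Import HBNNSimple.

(** If a or b is infinite, then so are both differences, and fine maps them
    to 0. *)
Lemma fine_scaleB r (a b : \bar R) :
  0 < r -> fine (r%:E * a - r%:E * b)%E = r * fine (a - b)%E.
Proof.
move=> r0; case: a => [a| |]; case: b => [b| |] //=;
  by rewrite ?gt0_muley ?gt0_muleNy ?lte_fin//= ?mulr0// ?mulrBr.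
Qed.

Definition rescales s r :=
  forall A, measurable A -> mu (s @^-1` A) = (r%:E * mu A)%E.

Lemma rescales_inv s t r : measurable_fun setT t ->
  0 < r -> cancel s t -> rescales s r -> rescales t r^-1.
Proof.
move=> mt r0 st sr A mA.
have -> : mu A = mu (s @^-1` (t @^-1` A)).
  by rewrite -comp_preimage (_ : t \o s = id)//; apply/funext => x /=.
rewrite sr; last by rewrite -[X in measurable X]setTI; exact: mt.
by rewrite muleA -EFinM mulVf ?gt_eqF// mul1e.
Qed.

Lemma nnsfun_comp s (ms : measurable_fun setT s) (h : {nnsfun T >-> R}) :
  {g : {nnsfun T >-> R} | g = h \o s :> (T -> R)}.
Proof.
have mhs : measurable_fun setT (h \o s) by exact: measurableT_comp.
have fhs : finite_set (range (h \o s)).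
  by apply: sub_finite_set (@fimfunP _ _ h) => _ [x _ <-]; exists (s x).
have nhs x : 0 <= (h \o s) x by [].
pose m1 := isMeasurableFun.Build _ _ _ _ (h \o s) mhs.
pose m2 := FiniteImage.Build _ _ (h \o s) fhs.
pose m3 := isNonNegFun.Build _ _ (h \o s) nhs.
pose g : {nnsfun T >-> R} := HB.pack (h \o s) m1 m2 m3.
by exists g.
Qed.

Lemma sintegral_comp s r (h : {nnsfun T >-> R}) :
  rescales s r -> sintegral mu (h \o s) = (r%:E * sintegral mu h)%E.
Proof.
move=> sr; rewrite !sintegralET.
rewrite ge0_mule_fsumr; last by move=> x; exact: nnsfun_mulemu_ge0.
apply: eq_fsbigr => x _; rewrite comp_preimage sr; last first.
  exact: measurable_funPTI.
by rewrite muleCA.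
Qed.

(** A simple function h below f yields the simple function h \o s below
    f \o s. *)
Lemma le_integral_comp s r f : measurable_fun setT s ->
  0 < r -> rescales s r -> (forall x, 0 <= f x)%E ->
  (r%:E * \int[mu]_x f x <= \int[mu]_x f (s x))%E.
Proof.
move=> ms r0 sr f0; rewrite -lee_pdivlMl// !ge0_integralTE//.
apply: ge_ereal_sup => _ [h /= hf <-].
rewrite lee_pdivlMl// -(sintegral_comp _ sr).
have [g gE] := nnsfun_comp ms h.
by apply: ereal_sup_ubound; exists g => [x|]; rewrite gE//=.
Qed.

Lemma ge0_integral_comp s t r f :
  measurable_fun setT s -> measurable_fun setT t ->
  cancel s t -> cancel t s -> 0 < r -> rescales s r -> (forall x, 0 <= f x)%E ->
  (\int[mu]_x f (s x) = r%:E * \int[mu]_x f x)%E.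
Proof.
move=> ms mt st ts r0 sr f0; apply/eqP; rewrite eq_le le_integral_comp// andbT.
rewrite -lee_pdivrMl//.
have tr := rescales_inv mt r0 st sr.
apply: le_trans (le_integral_comp mt _ tr (fun x => f0 (s x))) _.
  by rewrite invr_gt0.
by under eq_integral do rewrite ts.
Qed.

Lemma Rintegral_comp s t r (f : T -> R) (D : set T) :
  measurable_fun setT s -> measurable_fun setT t ->
  cancel s t -> cancel t s -> 0 < r -> rescales s r ->
  \int[mu]_(x in s @^-1` D) f (s x) = r * \int[mu]_(x in D) f x.
Proof.
move=> ms mt st ts r0 sr.
rewrite /Rintegral integral_mkcond [in RHS]integral_mkcond.
set g : T -> \bar R := _ \_ D.
transitivity (fine (\int[mu]_x (g \o s) x)).
  by congr fine; apply: eq_integral => x _; rewrite /g /= /patch.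
rewrite [in LHS]integralE [in RHS]integralE funepos_comp funeneg_comp.
rewrite (ge0_integral_comp ms mt st ts r0 sr (funepos_ge0 g)).
rewrite (ge0_integral_comp ms mt st ts r0 sr (funeneg_ge0 g)).
exact: fine_scaleB.
Qed.

Lemma le_integral_scale r f : 0 < r -> (forall x, 0 <= f x)%E ->
  (r%:E * \int[mu]_x f x <= \int[mu]_x (r%:E * f x))%E.
Proof.
move=> r0 f0; rewrite -lee_pdivlMl// !ge0_integralTE//; last first.
  by move=> x; rewrite mule_ge0// lee_fin ltW.
apply: ge_ereal_sup => _ [h /= hf <-].
rewrite lee_pdivlMl// -sintegralrM.
apply: ereal_sup_ubound; exists (scale_nnsfun h (ltW r0)) => //= x.
by rewrite EFinM lee_pmul2l.
Qed.

Lemma ge0_integral_scale r f : 0 < r -> (forall x, 0 <= f x)%E ->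
  (\int[mu]_x (r%:E * f x) = r%:E * \int[mu]_x f x)%E.
Proof.
move=> r0 f0; apply/eqP; rewrite eq_le le_integral_scale// andbT.
rewrite -lee_pdivrMl//.
apply: le_trans (le_integral_scale _ _) _; rewrite ?invr_gt0//.
  by move=> x; rewrite mule_ge0// lee_fin ltW.
by under eq_integral do rewrite muleA -EFinM mulVf ?gt_eqF// mul1e.
Qed.

(** Homogeneity for every real function f: where the integral of f is not
    finite, its real value is 0, and so is that of r * f when r is not 0. *)
Lemma RintegralZ (D : set T) r (f : T -> R) :
  \int[mu]_(x in D) (r * f x) = r * \int[mu]_(x in D) f x.
Proof.
wlog r0 : r f / 0 < r => [pos|].
  have [r0|r0|->] := ltgtP r 0; last 2 first.
  - exact: pos.
  - rewrite mul0r; under eq_Rintegral do rewrite mul0r.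
    by rewrite /Rintegral integral0.
  have -> : \int[mu]_(x in D) (r * f x) = \int[mu]_(x in D) (- r * - f x).
    by apply: eq_Rintegral => x _; rewrite mulrNN.
  rewrite pos ?oppr_gt0// mulNr -mulrN; congr (_ * _).
  rewrite /Rintegral integral_mkcond [in RHS]integral_mkcond.
  set g : T -> \bar R := _ \_ D; set h : T -> \bar R := _ \_ D.
  have -> : g = (\- h)%E.
    by apply/funext => x; rewrite /g /h /patch; case: ifP => //; rewrite oppe0.
  rewrite integralE [in RHS]integralE funeposN funenegN.
  case: (\int[mu]_x h^\- x)%E => [b| |];
    by case: (\int[mu]_x h^\+ x)%E => [a| |] //=; rewrite ?opprB ?oppr0.
rewrite /Rintegral integral_mkcond [in RHS]integral_mkcond.
set g : T -> \bar R := _ \_ D; set h : T -> \bar R := _ \_ D.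
have -> : g = (fun x => r%:E * h x)%E.
  by apply/funext => x; rewrite /g /h /patch; case: ifP => //; rewrite mule0.
rewrite [in LHS]integralE [in RHS]integralE.
rewrite ge0_funeposM ?ge0_funenegM ?ltW// !ge0_integral_scale//.
exact: fine_scaleB.
Qed.

End integral_scaling.

(** * Lebesgue measure on tuples: homotheties and the unit box *)

Section tuple_scaling.
Context {R : realType}.
Implicit Type c : R.

Lemma lebesgue_rescales c : 0 < c ->
  rescales (@lebesgue_measure R)
    ( *%R c : measurableTypeR R -> measurableTypeR R) c^-1.
Proof.
move=> c0 A mA; have c0' : 0 <= c by exact: ltW.
(* By uniqueness of Lebesgue measure, it suffices to compare it on intervals
   with c times its image under the homothety. *)
transitivity (c^-1%:E * pushforward (mscale (NngNum c0') lebesgue_measure)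
    ( *%R c : measurableTypeR R -> measurableTypeR R) A)%E.
  by rewrite /pushforward /mscale /= muleA -EFinM mulVf ?gt_eqF// mul1e.
congr (_ * _)%E; apply/esym.
apply: lebesgue_measure_unique => // _ [[a b]] _ <-.
transitivity (c%:E * lebesgue_measure `](c^-1 * a)%R, (c^-1 * b)%R])%E;
  last first.
  congr (_ * lebesgue_measure _)%E; apply/seteqP.
  by split => x /=; rewrite !in_itv/= ltr_pdivrMl// ler_pdivlMl.
rewrite !lebesgue_measure_itv /= !lte_fin ltr_pM2l ?invr_gt0//.
case: ifPn => _; last by rewrite mule0.
by rewrite -!EFinB -EFinM -mulrBr mulrA divff ?gt_eqF// mul1r.
Qed.

Definition tuple_scale p c (u : p.-tuple R) : p.-tuple R :=
  map_tuple ( *%R c) u.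

Lemma tuple_scaleK p c : c != 0 -> cancel (@tuple_scale p c) (tuple_scale c^-1).
Proof. by move=> c0 u; apply: eq_from_tnth => i; rewrite !tnth_map mulKf. Qed.

Lemma measurable_tuple_scale p c : measurable_fun setT (@tuple_scale p c).
Proof.
apply/measurable_fun_tnthP => i.
rewrite (_ : _ \o _ =
  ( *%R c : measurableTypeR R -> measurableTypeR R) \o (@tnth p R)^~ i);
  last by apply/funext => u /=; rewrite tnth_map.
apply: measurableT_comp; first exact: mulrl_measurable.
exact: measurable_tnth.
Qed.

(** The section at x of the preimage of A under the homothety is the preimage
    of the section of A at c * x. So one factor c^-1 comes from the first
    coordinate, the others from the inductive hypothesis on the sections. *)
Lemma tuple_lebesgue_rescales p c : 0 < c ->
  rescales (tuple_lebesgue p) (@tuple_scale p c) (c^-1 ^+ p).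
Proof.
move=> c0; elim: p => [A mA|p IH A mA].
  rewrite expr0 mul1e (_ : _ @^-1` A = A)//; apply/funext => u.
  by congr A; rewrite [LHS]tuple0 [RHS]tuple0.
pose B := @tuple_cons R p @^-1` A.
have mB : measurable B.
  by rewrite -[X in measurable X]setTI; exact: measurable_tuple_cons.
pose F x := tuple_lebesgue p (xsection B x).
have mF : measurable_fun setT F by exact: measurable_fun_xsection.
have mc : measurable_fun setT
  ( *%R c : measurableTypeR R -> measurableTypeR R).
  exact: mulrl_measurable.
have mc' : measurable_fun setT
  ( *%R c^-1 : measurableTypeR R -> measurableTypeR R).
  exact: mulrl_measurable.
have cn0 : c != 0 by rewrite gt_eqF.
rewrite [RHS]/= /consm /pushforward -/B /product_measure1.
rewrite -/(\int[_]_x F x)%E exprSr EFinM -muleA.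
rewrite -(ge0_integral_comp mc mc' (mulKf cn0) (mulVKf cn0) _
  (lebesgue_rescales c0)) ?invr_gt0//.
rewrite -ge0_integralZl//; last 2 first.
- exact: measurableT_comp.
- by rewrite lee_fin exprn_ge0// invr_ge0 ltW.
apply: eq_integral => x _ /=.
rewrite -IH; last exact: measurable_xsection.
congr (tuple_lebesgue p _); apply/seteqP; split => u /=;
rewrite !xsectionE /B /= (_ : tuple_scale c (tuple_cons (x, u)) =
  tuple_cons (c * x, tuple_scale c u))//; exact: val_inj.
Qed.

Lemma measurable_unit_box p : measurable (@unit_box R p).
Proof.
rewrite (_ : unit_box = \bigcap_(a in [set: 'I_p])
  ((@tnth p R)^~ a @^-1` `[0, 1])); last first.
  apply/seteqP; split => u /= u01 a; first by move=> _; rewrite /= in_itv/=.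
  by have := u01 a I; rewrite /= in_itv/=.
apply: fin_bigcap_measurable => // a _.
by rewrite -[X in measurable X]setTI; exact: measurable_tnth.
Qed.

Lemma tuple_lebesgue_unit_box p : tuple_lebesgue p (@unit_box R p) = 1%E.
Proof.
elim: p => [|p IH].
  by rewrite /= diracE mem_set// => -[].
rewrite /= /consm /pushforward (_ : _ @^-1` _ = `[0%R, 1%R] `*` @unit_box R p).
  rewrite product_measure1E//; last exact: measurable_unit_box.
  by rewrite IH mule1 [LHS]lebesgue_measure_itv /= lte_fin ltr01 oppr0 adde0.
apply/seteqP; split => -[x u] /=.
  move=> xu; split; first by have := xu ord0; rewrite in_itv.
  by move=> a; have := xu (lift ord0 a); rewrite (tnth_nth 0) /= -tnth_nth.
move=> [x01 u01] a; have [b ->|->] := unliftP ord0 a.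
  by have := u01 b; rewrite !(tnth_nth 0).
by move: x01; rewrite in_itv.
Qed.

End tuple_scaling.

(** * Pairing of coordinate p-covectors and p-vectors *)

Section exterior.
Context {R : realType} {p n : nat}.
Implicit Types (I J : incr p n).

Definition basis_rows I : 'M[R]_(p, n) := \matrix_(a < p) delta_mx 0 (val I a).

Lemma incr_inj I : injective (val I).
Proof.
have /forallP mono := valP I.
have lt_neq (a b : 'I_p) : (a < b)%N -> val I a != val I b.
  move=> ab; have /forallP/(_ b)/implyP/(_ ab) := mono a.
  by apply: contraTneq => ->; rewrite ltnn.
move=> a b Iab; apply/val_inj; case: (ltngtP a b) => // /lt_neq.
  by rewrite Iab eqxx.
by rewrite Iab eqxx.
Qed.

(** If some index I a is not listed in J, then row a of the minor selected by J
    is zero. Otherwise I lists p of the p indices in J. *)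
Lemma wedge_basis_neq0 I J : wedge (basis_rows I) J != 0 ->
  codom (val I) =i codom (val J).
Proof.
rewrite ffunE => det_neq0.
have IJ a : val I a \in codom (val J).
  apply: contraNT det_neq0 => IJ; rewrite (expand_det_row _ a) big1// => b _.
  rewrite !mxE eqxx /= (_ : _ == _ = false) ?mul0r//.
  by apply: contraNF IJ => /eqP <-; exact: codom_f.
have /subset_cardP eqIJ : #|codom (val I)| = #|codom (val J)|.
  by rewrite !card_codom//; exact: incr_inj.
by apply/eqIJ/fintype.subsetP => _ /codomP[a ->].
Qed.

(** A nonzero pairing has a nonzero term, and the index of that term lists the
    same coordinates as I and as J. *)
Lemma pairing_basis_neq0 I J :
  pairing (wedge (basis_rows I)) (wedge (basis_rows J)) != 0 ->
  codom (val I) =i codom (val J).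
Proof.
move=> IJ.
have [K] : exists K, wedge (basis_rows I) K * wedge (basis_rows J) K != 0.
  apply/existsP; apply: contraNT IJ; rewrite negb_exists => /forallP IJ.
  by rewrite /pairing big1// => K _; apply/eqP; rewrite -[_ == _]negbK IJ.
rewrite mulf_eq0 negb_or => /andP[IK JK] i.
by rewrite (wedge_basis_neq0 IK) (wedge_basis_neq0 JK).
Qed.

Lemma wedgeZ (c : R) (A : 'M[R]_(p, n)) : wedge (c *: A) = c ^+ p *: wedge A.
Proof.
apply/ffunP => I; rewrite !ffunE -[RHS]/(_ * _) -detZ; congr (\det _).
by apply/matrixP => a b; rewrite !mxE.
Qed.

Lemma pairingZl (c : R) (f g : ext R p n) :
  pairing (c *: f) g = c * pairing f g.
Proof.
by rewrite /pairing mulr_sumr; apply: eq_bigr => I _; rewrite ffunE mulrA.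
Qed.

Lemma pairingZr (c : R) (f g : ext R p n) :
  pairing f (c *: g) = c * pairing f g.
Proof.
by rewrite /pairing mulr_sumr; apply: eq_bigr => I _; rewrite ffunE mulrCA.
Qed.

End exterior.

(** * Small cubes and averages over them *)

Section small_cubes.
Context {R : realType} {p n : nat} (k : nat) (hk : (0 < k)%N).
Context (kk : {ffun 'I_n -> 'I_k}) (t : face p n).
Implicit Types (x y : 'rV[R]_n) (u : p.-tuple R).

Let k0 : (k%:R : R) != 0. Proof. by rewrite pnatr_eq0 -lt0n. Qed.

Lemma edgesE : edges kk t = k%:R^-1 *: basis_rows (dir t) :> 'M[R]_(p, n).
Proof.
apply/matrixP => a i; rewrite !mxE -mulrBr; congr (_ * _).
by rewrite addrA [_ + _%:R]addrC addrK.
Qed.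

Lemma small_mapE x i : small_map kk x 0 i = k%:R^-1 * ((kk i)%:R + x 0 i).
Proof. by rewrite mxE [in LHS]mxE. Qed.

Lemma small_map_inj : injective (small_map kk : 'rV[R]_n -> _).
Proof.
move=> x y xy; apply/rowP => i; move/rowP/(_ i) : xy; rewrite !small_mapE.
by move/(mulfI (invr_neq0 k0))/addrI.
Qed.

Lemma plane_dir x u a :
  plane (dir t) x u 0 (val (dir t) a) = x 0 (val (dir t) a) + tnth u a.
Proof.
rewrite !mxE summxE (bigD1 a)//= !mxE !eqxx mulr1 big1 ?addr0// => b ba.
by rewrite !mxE eqxx /= (inj_eq (@incr_inj _ _ _)) eq_sym (negbTE ba) mulr0.
Qed.

Lemma plane_notfree x u i :
  i \notin free_coord t -> plane (dir t) x u 0 i = x 0 i.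
Proof.
move=> it; rewrite !mxE summxE big1 ?addr0// => a _.
rewrite !mxE eqxx /= (_ : _ == _ = false) ?mulr0//.
by apply: contraNF it => /eqP ->; exact: codom_f.
Qed.

Lemma dir_free a : val (dir t) a \in free_coord t.
Proof. exact: codom_f. Qed.

Lemma face_setE u :
  face_set t (plane (dir t) (corner t) u) <-> unit_box u.
Proof.
split=> [[u01 _] a|u01].
  by have := u01 (val (dir t) a); rewrite plane_dir mxE dir_free add0r.
split=> [i|i it]; last by rewrite plane_notfree// mxE (negbTE it).
have [it|it] := boolP (i \in free_coord t).
  have /codomP[a ->] : i \in codom (val (dir t)) by [].
  by rewrite plane_dir mxE dir_free add0r.
by rewrite plane_notfree// mxE (negbTE it) ler0n lern1 leq_b1.
Qed.

Lemma small_cubeE u : small_cube kk t (small_param kk t u) <-> unit_box u.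
Proof.
rewrite -face_setE; split=> [[x tx /small_map_inj <-]//|tu].
by exists (plane (dir t) (corner t) u).
Qed.

(** The isometric parametrization, which defines the average, and the
    parametrization by the unit box, which defines the integral of a form,
    differ by a homothety. *)
Lemma plane_scale u :
  plane (dir t) (small_corner kk t) (tuple_scale k%:R^-1 u) =
  small_param kk t u.
Proof.
apply/rowP => i; have [it|it] := boolP (i \in free_coord t).
  have /codomP[a ->] : i \in codom (val (dir t)) by [].
  by rewrite plane_dir tnth_map !small_mapE plane_dir -mulrDr addrA.
by rewrite plane_notfree// !small_mapE plane_notfree.
Qed.

Lemma small_cube_fixed y i : small_cube kk t y -> i \notin free_coord t ->
  y 0 i = k%:R^-1 * ((kk i)%:R + (fixed_val t i)%:R).
Proof. by move=> [z [_ tz] <-] it; rewrite small_mapE tz. Qed.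

(** Change of variables by the homothety of ratio 1/k: the Jacobian k^-p is
    also the volume of the small cube, by which the average divides. *)
Lemma averageE (w : 'rV[R]_n -> R) :
  average kk t w =
  \int[tuple_lebesgue p]_(u in unit_box) w (small_param kk t u).
Proof.
pose s := @tuple_scale R p k%:R^-1; pose s' := @tuple_scale R p k%:R.
have kV0 : 0 < k%:R^-1 :> R by rewrite invr_gt0 ltr0n.
have ms : measurable_fun setT s by exact: measurable_tuple_scale.
have ms' : measurable_fun setT s' by exact: measurable_tuple_scale.
have ss' : cancel s s'.
  by rewrite /s' -{1}[k%:R]invrK; apply: tuple_scaleK; rewrite invr_neq0.
have s's : cancel s' s by exact: tuple_scaleK.
pose B : set (p.-tuple R) :=
  plane (dir t) (small_corner kk t) @^-1` small_cube kk t.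
have sB : s @^-1` B = @unit_box R p.
  by apply/seteqP; split => u; rewrite /B /= plane_scale => /small_cubeE.
have BE : B = s' @^-1` (@unit_box R p).
  by rewrite -sB -comp_preimage (_ : s \o s' = id)//; apply/funext => u /=.
have mB : measurable B.
  rewrite BE -[X in measurable X]setTI; apply: ms' => //.
  exact: measurable_unit_box.
have sr := tuple_lebesgue_rescales (p := p) kV0; rewrite invrK in sr.
have kp0 : 0 < k%:R ^+ p :> R by rewrite exprn_gt0// ltr0n.
have volB : small_volume kk t = (k%:R ^+ p)^-1 :> R.
  rewrite /small_volume /volume -/B.
  rewrite (_ : tuple_lebesgue p B = ((k%:R ^+ p)^-1)%:E)//.
  rewrite -[LHS]mul1e -[in LHS](@mulVf _ (k%:R ^+ p : R)) ?gt_eqF//.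
  rewrite EFinM -muleA -sr// sB.
  by rewrite [X in (_ * X)%E]tuple_lebesgue_unit_box mule1.
rewrite /average volB invrK /plane_integral -/B.
rewrite -(Rintegral_comp _ B ms ms' ss' s's kp0 sr) sB.
by apply: eq_Rintegral => u _; rewrite plane_scale.
Qed.

End small_cubes.

(** * The coefficient of the lowest order form *)

Section face_form.
Context {R : realType} {p n : nat}.
Implicit Types (s t : face p n) (x y : 'rV[R]_n).

Definition face_coef s y : R :=
  \prod_(i | i \notin free_coord s)
     (y 0 i ^+ (fixed_val s i) * (1 - y 0 i) ^+ (1 - fixed_val s i)).

Lemma lowest_formE s y :
  lowest_form s y = face_coef s y *: wedge (basis_rows (dir s)).
Proof. by []. Qed.

(** The coefficient only involves coordinates that are fixed on a small cube
    parallel to s. *)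
Lemma face_coef_const s t k (kk : {ffun 'I_n -> 'I_k}) x y :
  free_coord s =i free_coord t -> small_cube kk t x -> small_cube kk t y ->
  face_coef s x = face_coef s y.
Proof.
move=> st tx ty; apply: eq_bigr => i; rewrite st => it.
by rewrite (small_cube_fixed tx it) (small_cube_fixed ty it).
Qed.

End face_form.

Theorem proposition3p3 (R : realType) (p n : nat) (sigma : face p n)
    (w : 'rV[R]_n -> R) (hw : smooth_on_cube w)
    (k : nat) (hk : (0 < k)%N) (kk : {ffun 'I_n -> 'I_k}) (tau : face p n)
    (o : bool) (x : 'rV[R]_n) (hx : small_cube kk tau x) :
  form_integral kk tau o (fun y => w y *: lowest_form sigma y) =
  average kk tau w * pairing (lowest_form sigma x) (vect kk tau o).
Proof.
rewrite averageE// /vect pairingZr mulrCA /form_integral; congr (_ * _).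
rewrite mulrC -RintegralZ; apply: eq_Rintegral => u /[!inE] u01.
rewrite pairingZl mulrC; congr (_ * _).
rewrite !lowest_formE !pairingZl edgesE wedgeZ pairingZr.
have [->|/pairing_basis_neq0 st] := eqVneq
  (pairing (wedge (basis_rows (dir sigma)))
           (wedge (basis_rows (dir tau))) : R) 0.
  by rewrite !mulr0.
congr (_ * _); apply: (@face_coef_const _ _ _ _ tau _ kk) => //.
exact/small_cubeE.
Qed.
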